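(* Let $n$ be a positive integer and $a,b$ positive integers. Suppose that there exists a set of $f$ mutually Type~II weakly unbiased Hadamard matrices of order $n$ such that $\sigma(H,K)=\{2a,2b\}$ for any two distinct members $H,K$. Then: (i) $f\le\Big\lfloor\frac{n^4-10n^3+55n^2-110n+184}{5!}\Big\rfloor$; (ii) if $15n^2-30n+16-4(3n-2)(a^2+b^2)+16a^2b^2>0$ and $5(n-2)-2a^2-2b^2\ge0$, then \[ f\le\Big\lfloor\frac{(n^2-4a^2)(n^2-4b^2)}{15n^2-30n+16-4(3n-2)(a^2+b^2)+16a^2b^2}\Big\rfloor . \]
   Context: A Hadamard matrix of order $n$ is an $n\times n$ $(\pm1)$-matrix $H$ with $HH^T=nI_n$. For Hadamard matrices $H,K$ with $a_{ij}$ the $(i,j)$-entry of $HK^T$, $\sigma(H,K)=\{|a_{ij}|: i,j\}$. $H,K$ are Type~II weakly unbiased if $a_{ij}\equiv0\pmod4$ for all $i,j$ and $|\sigma(H,K)|\le 2$, unbiased pairs (all $|a_{ij}|=\sqrt n$) being excluded. A set is mutually Type~II weakly unbiased if every pair of distinct members is Type~II weakly unbiased. *)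

(* Defs.v *)
From HB Require Import structures.
From mathcomp Require Import all_boot all_order all_algebra all_field.
From mathcomp Require Import finmap.

Set Implicit Arguments.
Unset Strict Implicit.
Unset Printing Implicit Defensive.

Import Order.TTheory GRing.Theory Num.Theory.

Local Open Scope ring_scope.

Definition hadamard (n : nat) (H : 'M[int]_n) : Prop :=
  (forall i j, H i j = 1 \/ H i j = -1) /\ H *m H^T = (n%:R)%:M.

Definition sigma (n : nat) (H K : 'M[int]_n) : {fset int} :=
  [fset `|(H *m K^T) i j| | i in 'I_n, j in 'I_n]%fset.

(* The square root is taken in algC, so that n need not be a square. *)
Definition unbiased (n : nat) (H K : 'M[int]_n) : Prop :=
  forall i j, `|(H *m K^T) i j|%:~R = sqrtC n%:R :> algC.

Definition type2_weakly_unbiased (n : nat) (H K : 'M[int]_n) : Prop :=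
  [/\ forall i j, ((H *m K^T) i j = 0 %[mod 4])%Z,
      (#|` sigma H K| <= 2)%N
    & ~ unbiased H K].

Definition mutually_type2_weakly_unbiased
    (n : nat) (S : {fset 'M[int]_n}) : Prop :=
  forall H K : 'M[int]_n,
    H \in S -> K \in S -> H != K -> type2_weakly_unbiased H K.

(* Main.v *)
(** For z in {1, -1}^n with coordinate sum t, the elementary symmetric
    functions e_k of z satisfy t e_(k+1) = (k+2) e_(k+2) + (n-k) e_k, whence
    t (t^2 - 4a^2) (t^2 - 4b^2)
      = 120 e_5 + 12 (5(n-2) - 2a^2 - 2b^2) e_3 + D e_1.
    Apply this to the coordinatewise product of any two of the fn rows of the
    matrices: t is then their inner product, so the left-hand side is the
    Gram-type matrix G I, with G = n (n^2 - 4a^2) (n^2 - 4b^2), whereas e_k is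
    a Gram matrix of rank at most C(n, k).
    (i) If G <> 0, comparing ranks gives fn <= C(n,1) + C(n,3) + C(n,5). When
    f >= 2, G = 0 would put an entry of modulus n into some H K^T; the rows of
    H K^T have squared norm n^2, so the other entries would vanish.
    (ii) Evaluating the quadratic forms at the vector formed by one column of
    the stacked rows gives G fn >= D (fn)^2, as e_3 and e_5 contribute
    nonnegatively. *)

Require Import Defs.
From HB Require Import structures.
From mathcomp Require Import all_boot all_order all_algebra all_field.
From mathcomp Require Import finmap.
From mathcomp Require Import zify ring lra.

Set Implicit Arguments.
Unset Strict Implicit.
Unset Printing Implicit Defensive.

Import Order.TTheory GRing.Theory Num.Theory.

Local Open Scope ring_scope.

(** * Elementary symmetric functions of sign vectors *)

Definition esym (R : comNzRingType) (n k : nat) (z : 'I_n -> R) : R :=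
  \sum_(T : {set 'I_n} | #|T| == k) \prod_(i in T) z i.

Definition symdiff1 (n : nat) (i : 'I_n) (T : {set 'I_n}) : {set 'I_n} :=
  if i \in T then T :\ i else i |: T.

Lemma symdiff1K (n : nat) (i : 'I_n) : involutive (symdiff1 i).
Proof.
move=> T; rewrite /symdiff1; case: (boolP (i \in T)) => iT.
  by rewrite setD11 setD1K.
by rewrite setU11 setU1K.
Qed.

Lemma card_symdiff1 (n : nat) (i : 'I_n) (T : {set 'I_n}) :
  #|symdiff1 i T| = if i \in T then #|T|.-1 else #|T|.+1.
Proof.
rewrite /symdiff1; case: ifP => iT; last by rewrite cardsU1 iT.
by rewrite [in RHS](cardsD1 i) iT.
Qed.

Lemma prod_symdiff1 (R : comNzRingType) (n : nat) (z : 'I_n -> R)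
    (i : 'I_n) (T : {set 'I_n}) (z2 : z i ^+ 2 = 1) :
  \prod_(j in symdiff1 i T) z j = z i * \prod_(j in T) z j.
Proof.
rewrite /symdiff1; case: ifP => iT; last by rewrite big_setU1 ?iT.
by rewrite [in RHS](big_setD1 i) //= mulrA -expr2 z2 mul1r.
Qed.

Lemma esym0 (R : comNzRingType) (n : nat) (z : 'I_n -> R) : esym 0 z = 1.
Proof.
rewrite /esym (big_pred1 set0) ?big_set0 // => T.
by rewrite /= cards_eq0.
Qed.

(* [z i * z_T = z_(symdiff1 i T)], where [z_T] is the product of [z] over
   [T]; the coefficient of [z_U] counts the [i] leading from a [k]-set to
   [U]. *)
Lemma mul_sum_esym (R : comNzRingType) (n k : nat) (z : 'I_n -> R)
    (z2 : forall i, z i ^+ 2 = 1) :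
  (\sum_i z i) * esym k z =
  \sum_(U : {set 'I_n})
    #|[set i | #|symdiff1 i U| == k]|%:R * \prod_(j in U) z j.
Proof.
rewrite mulr_suml.
under eq_bigr => i _.
  rewrite mulr_sumr (reindex_inj (inv_inj (symdiff1K i))) /=.
  under eq_bigr => T _.
    rewrite prod_symdiff1 // mulrA -expr2 z2 mul1r.
  over.
  rewrite big_mkcond /=.
over.
rewrite exchange_big /=; apply: eq_bigr => U _.
rewrite -big_mkcond /= (eq_bigl (mem [set i | #|symdiff1 i U| == k])).
  by rewrite sumr_const mulr_natl.
by move=> i; rewrite !inE.
Qed.

Lemma esym1 (R : comNzRingType) (n : nat) (z : 'I_n -> R)
    (z2 : forall i, z i ^+ 2 = 1) : esym 1 z = \sum_i z i.
Proof.
rewrite -[RHS]mulr1 -(esym0 z) mul_sum_esym // /esym big_mkcond /=.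
apply: eq_bigr => U _.
suff -> : #|[set i | #|symdiff1 i U| == 0%N]| = (#|U| == 1%N).
  by case: eqP => _; rewrite ?mul1r ?mul0r.
case: eqP => [U1|nU1].
  rewrite -[RHS]U1; apply: eq_card => i; rewrite !inE card_symdiff1 U1.
  by case: ifP.
apply/eqP; rewrite cards_eq0 -subset0; apply/subsetP => i.
rewrite !inE card_symdiff1; case: ifP => // iU; move: nU1.
by rewrite (cardsD1 i) iU; lia.
Qed.

(** A set of size [k.+2] reaches a [k.+1]-set by deleting any of its [k.+2] elements, a set of size
    [k] by adding any of the [n - k] others; no other set reaches one. For [k > n] the ring
    difference is harmless, since [esym k z] is then an empty sum. *)
Lemma esymS (R : comNzRingType) (n k : nat) (z : 'I_n -> R)
    (z2 : forall i, z i ^+ 2 = 1) :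
  (\sum_i z i) * esym k.+1 z =
  k.+2%:R * esym k.+2 z + (n%:R - k%:R) * esym k z.
Proof.
rewrite mul_sum_esym // /esym !mulr_sumr.
rewrite ![\sum_(T : {set 'I_n} | #|T| == _) _]big_mkcond -big_split /=.
apply: eq_bigr => U _.
have cardC : (n%:R - #|U|%:R : R) = #|~: U|%:R.
  by rewrite -[in n%:R](card_ord n) -(cardsC U) natrD addrC addKr.
case: (eqVneq #|U| k) => [Uk|nUk].
  rewrite Uk (ltn_eqF (leqW (ltnSn k))) add0r.
  rewrite Uk in cardC; rewrite cardC; congr (_%:R * _).
  apply: eq_card => i; rewrite !inE card_symdiff1 Uk.
  by case: (i \in U) => /=; lia.
case: (eqVneq #|U| k.+2) => [Uk2|nUk2].
  rewrite addr0; congr (_%:R * _); rewrite -[RHS]Uk2.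
  apply: eq_card => i; rewrite !inE card_symdiff1 Uk2 /=.
  by case: (i \in U) => /=; lia.
rewrite addr0 (_ : [set _ | _] = set0) ?cards0 ?mul0r //.
apply/setP => i; rewrite !inE card_symdiff1; case: ifP => iU.
  by move: nUk2; rewrite (cardsD1 i) iU /=; lia.
by lia.
Qed.

(** The recurrence of [esymS] expresses [t ^+ 3] and [t ^+ 2 * esym 3 z] through [esym 1], [esym 3]
    and [esym 5]. The quintic is odd in [t], so even indices do not occur. *)
Lemma quintic_esym (R : comNzRingType) (n : nat) (A B : R) (z : 'I_n -> R)
    (z2 : forall i, z i ^+ 2 = 1) (N := n%:R : R) (t := \sum_i z i) :
  t * (t ^+ 2 - 4 * A ^+ 2) * (t ^+ 2 - 4 * B ^+ 2) =
    120 * esym 5 z + 12 * (5 * (N - 2) - 2 * A ^+ 2 - 2 * B ^+ 2) * esym 3 z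
    + (15 * N ^+ 2 - 30 * N + 16 - 4 * (3 * N - 2) * (A ^+ 2 + B ^+ 2)
       + 16 * A ^+ 2 * B ^+ 2) * esym 1 z.
Proof.
have e1 := esymS 0 z2; have e2 := esymS 1 z2.
have e3 := esymS 2 z2; have e4 := esymS 3 z2.
rewrite esym0 -/t -/N in e1 e2 e3 e4 *.
have tE : t = esym 1 z by rewrite esym1.
have t2 : t ^+ 2 = 2 * esym 2 z + N by rewrite expr2 {2}tE e1; ring.
have t3 : t ^+ 3 = 6 * esym 3 z + (3 * N - 2) * esym 1 z.
  by rewrite exprS t2 mulrDr [t * (_ * _)]mulrCA e2 tE; ring.
have t4 : t ^+ 2 * esym 3 z =
    20 * esym 5 z + (7 * N - 18) * esym 3 z + (N - 1) * (N - 2) * esym 1 z.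
  rewrite expr2 -mulrA e3 mulrDr ![t * (_ * _)]mulrCA e2 e4; ring.
have -> : t * (t ^+ 2 - 4 * A ^+ 2) * (t ^+ 2 - 4 * B ^+ 2) =
    t ^+ 2 * t ^+ 3 - 4 * (A ^+ 2 + B ^+ 2) * t ^+ 3
    + 16 * A ^+ 2 * B ^+ 2 * t by ring.
have -> : t ^+ 2 * t ^+ 3 = 6 * (t ^+ 2 * esym 3 z) + (3 * N - 2) * t ^+ 3.
  by rewrite {1}t3 -tE; ring.
rewrite t4 t3 tE; ring.
Qed.

(** * Rank and positivity bounds for families of sign vectors *)

Lemma leq_card_of_dual (F : fieldType) (I J : finType) (P : {set J}) (c : F)
    (u : I -> J -> F) (v : J -> I -> F) (c0 : c != 0)
    (uv : forall i i', \sum_(j in P) u i j * v j i' = (i == i')%:R * c) :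
  (#|I| <= #|P|)%N.
Proof.
(* After scaling by [c^-1], the identity of order [#|I|] factors through dimension [#|P|]. *)
pose U := \matrix_(i < #|I|, j < #|P|) (c^-1 * u (enum_val i) (enum_val j)).
pose V := \matrix_(j < #|P|, i < #|I|) v (enum_val j) (enum_val i).
apply: (@mulmx1_min F _ _ U V); apply/matrixP => i i'; rewrite !mxE.
under eq_bigr => j _ do rewrite !mxE -mulrA.
rewrite -mulr_sumr.
rewrite -(big_enum_val (A := mem P)
  (fun j => u (enum_val i) j * v j (enum_val i'))) /=.
by rewrite uv (inj_eq enum_val_inj) mulrCA mulVf // mulr1.
Qed.

Lemma natr_ffactS (R : pzRingType) (n k : nat) :
  (n ^_ k.+1)%:R = (n ^_ k)%:R * (n%:R - k%:R) :> R.
Proof.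
rewrite ffactnSr natrM; case: (leqP k n) => [kn|nk]; first by rewrite natrB.
by rewrite ffact_small // !mul0r.
Qed.

Lemma natr_bin135 (n : nat) (N := n%:R : rat) :
  ('C(n, 1) + 'C(n, 3) + 'C(n, 5))%:R =
  N * ((N ^+ 4 - 10 * N ^+ 3 + 55 * N ^+ 2 - 110 * N + 184) / 120) :> rat.
Proof.
have C k : 'C(n, k)%:R = (n ^_ k)%:R / k`!%:R :> rat.
  by rewrite -bin_ffact natrM mulfK // pnatr_eq0 -lt0n fact_gt0.
rewrite !natrD !C !natr_ffactS ffactn0 -/N !factS fact0; by field.
Qed.

Lemma esym_mul (R : comNzRingType) (n k : nat) (x y : 'I_n -> R) :
  esym k (fun i => x i * y i) =
  \sum_(T : {set 'I_n} | #|T| == k) (\prod_(i in T) x i) * \prod_(i in T) y i.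
Proof. by apply: eq_bigr => T _; rewrite big_split. Qed.

(** The double sum is a sum of squares, one for each [k]-set; only the square for [T] is kept. *)
Lemma sum_esym_ge (R : realDomainType) (n k : nat) (I : finType) (v : I -> R)
    (x : I -> 'I_n -> R) (T : {set 'I_n}) (Tk : #|T| = k) :
  (\sum_p v p * \prod_(i in T) x p i) ^+ 2 <=
  \sum_p \sum_q v p * v q * esym k (fun i => x p i * x q i).
Proof.
have -> : \sum_p \sum_q v p * v q * esym k (fun i => x p i * x q i) =
    \sum_(U : {set 'I_n} | #|U| == k) (\sum_p v p * \prod_(i in U) x p i) ^+ 2.
  under eq_bigr => p _.
    under eq_bigr => q _ do rewrite esym_mul mulr_sumr.
    rewrite exchange_big /=.
  over.
  rewrite exchange_big /=; apply: eq_bigr => U _.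
  rewrite expr2 mulr_suml; apply: eq_bigr => p _.
  by rewrite mulr_sumr; apply: eq_bigr => q _; rewrite mulrACA.
rewrite (bigD1 T) /= ?Tk // lerDl; apply: sumr_ge0 => U _; exact: sqr_ge0.
Qed.

Lemma sum_esym_ge0 (R : realDomainType) (n k : nat) (I : finType) (v : I -> R)
    (x : I -> 'I_n -> R) :
  0 <= \sum_p \sum_q v p * v q * esym k (fun i => x p i * x q i).
Proof.
have [T /eqP Tk|T0] := pickP (fun T : {set 'I_n} => #|T| == k).
  exact: le_trans (sqr_ge0 _) (sum_esym_ge v x Tk).
rewrite big1 // => p _; rewrite big1 // => q _.
by rewrite /esym big_pred0 ?mulr0.
Qed.

Lemma gram_quintic (R : comNzRingType) (n : nat) (I : finType) (A B : R)
    (x : I -> 'I_n -> R) (N := n%:R : R)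
    (t := fun p q => \sum_i x p i * x q i)
    (x2 : forall p i, x p i ^+ 2 = 1)
    (xt : forall p q, p != q ->
       t p q * (t p q ^+ 2 - 4 * A ^+ 2) * (t p q ^+ 2 - 4 * B ^+ 2) = 0)
    (e := fun k p q => esym k (fun i => x p i * x q i)) (p q : I) :
  120 * e 5 p q + 12 * (5 * (N - 2) - 2 * A ^+ 2 - 2 * B ^+ 2) * e 3 p q
    + (15 * N ^+ 2 - 30 * N + 16 - 4 * (3 * N - 2) * (A ^+ 2 + B ^+ 2)
       + 16 * A ^+ 2 * B ^+ 2) * e 1 p q =
  (p == q)%:R * (N * (N ^+ 2 - 4 * A ^+ 2) * (N ^+ 2 - 4 * B ^+ 2)).
Proof.
rewrite -quintic_esym; last by move=> i; rewrite exprMn !x2 mulr1.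
have [<-|/xt xt0] := eqVneq p q; last by rewrite mul0r xt0.
have -> : \sum_i x p i * x p i = N.
  under eq_bigr => i _ do rewrite -expr2 x2.
  by rewrite sumr_const card_ord.
by rewrite mul1r.
Qed.

Lemma card_code_le_bin (F : fieldType) (n : nat) (I : finType) (A B : F)
    (x : I -> 'I_n -> F) (N := n%:R : F)
    (t := fun p q => \sum_i x p i * x q i)
    (x2 : forall p i, x p i ^+ 2 = 1)
    (xt : forall p q, p != q ->
       t p q * (t p q ^+ 2 - 4 * A ^+ 2) * (t p q ^+ 2 - 4 * B ^+ 2) = 0) :
  N * (N ^+ 2 - 4 * A ^+ 2) * (N ^+ 2 - 4 * B ^+ 2) != 0 ->
  (#|I| <= 'C(n, 1) + 'C(n, 3) + 'C(n, 5))%N.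
Proof.
move=> G0.
pose g1 := 15 * N ^+ 2 - 30 * N + 16 - 4 * (3 * N - 2) * (A ^+ 2 + B ^+ 2)
           + 16 * A ^+ 2 * B ^+ 2.
pose g3 := 12 * (5 * (N - 2) - 2 * A ^+ 2 - 2 * B ^+ 2).
(* The coefficient of [esym #|T|] in the quintic. It is put on one factor of the pairing only, so
   its sign and possible vanishing do not matter. *)
pose g (T : {set 'I_n}) : F :=
  (#|T| == 5)%:R * 120 + (#|T| == 3)%:R * g3 + (#|T| == 1)%:R * g1.
pose L k := [set T : {set 'I_n} | #|T| == k].
pose P := L 1%N :|: L 3 :|: L 5.
apply: (@leq_trans #|P|); last first.
  have cardL k : #|L k| = 'C(n, k) by rewrite card_draws card_ord.
  apply: leq_trans (leq_card_setU _ _) _; rewrite cardL leq_add2r.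
  by apply: leq_trans (leq_card_setU _ _) _; rewrite !cardL.
apply: (leq_card_of_dual (P := P) (u := fun p T => g T * \prod_(i in T) x p i)
  (v := fun T q => \prod_(i in T) x q i) G0) => p q.
rewrite -(gram_quintic x2 xt) !esym_mul -/g1 -/g3 !mulr_sumr.
rewrite ![\sum_(T : {set 'I_n} | #|T| == _) _]big_mkcond.
rewrite [LHS]big_mkcond -!big_split /=.
apply: eq_bigr => T _; rewrite !inE /g.
case: (eqVneq #|T| 1%N) => [->|_]; first by rewrite /=; ring.
case: (eqVneq #|T| 3) => [->|_]; first by rewrite /=; ring.
by case: (#|T| == 5); rewrite /=; ring.
Qed.

Lemma card_code_mul_le (R : realFieldType) (n : nat) (I : finType) (A B : R)
    (x : I -> 'I_n -> R) (N := n%:R : R)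
    (t := fun p q => \sum_i x p i * x q i)
    (D := 15 * N ^+ 2 - 30 * N + 16 - 4 * (3 * N - 2) * (A ^+ 2 + B ^+ 2)
          + 16 * A ^+ 2 * B ^+ 2)
    (x2 : forall p i, x p i ^+ 2 = 1)
    (xt : forall p q, p != q ->
       t p q * (t p q ^+ 2 - 4 * A ^+ 2) * (t p q ^+ 2 - 4 * B ^+ 2) = 0) :
  (0 < n)%N -> (0 < #|I|)%N -> 0 <= D ->
  0 <= 5 * (N - 2) - 2 * A ^+ 2 - 2 * B ^+ 2 ->
  #|I|%:R * D <= N * (N ^+ 2 - 4 * A ^+ 2) * (N ^+ 2 - 4 * B ^+ 2).
Proof.
move=> n0 I0 D0 C0; pose j := Ordinal n0; pose v p := x p j.
pose G := N * (N ^+ 2 - 4 * A ^+ 2) * (N ^+ 2 - 4 * B ^+ 2).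
pose E k := \sum_p \sum_q v p * v q * esym k (fun i => x p i * x q i).
(* Of the singletons only that of [j] is kept: there the sum is that of the squares
   [v p ^+ 2 = 1]. *)
have E1 : #|I|%:R ^+ 2 <= E 1%N.
  apply: le_trans (sum_esym_ge v x (cards1 j)).
  under [X in _ <= X ^+ 2]eq_bigr => p _ do rewrite big_set1 -expr2 x2.
  by rewrite sumr_const.
have E3 : 0 <= E 3 := sum_esym_ge0 _ _ _.
have E5 : 0 <= E 5 := sum_esym_ge0 _ _ _.
have EG : 120 * E 5 + 12 * (5 * (N - 2) - 2 * A ^+ 2 - 2 * B ^+ 2) * E 3
    + D * E 1%N = #|I|%:R * G.
  rewrite /E !mulr_sumr -!big_split /= -sumr_const mulr_suml.
  apply: eq_bigr => p _; rewrite !mulr_sumr -!big_split /=.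
  under eq_bigr => q _.
    rewrite ![_ * (v p * v q * _)]mulrCA -!mulrDr (gram_quintic x2 xt) -/G.
  over.
  rewrite (bigD1 p) //= eqxx /v -expr2 x2 !mul1r big1 ?addr0 // => q.
  by rewrite eq_sym => /negPf->; rewrite mul0r mulr0.
rewrite -(ler_pM2l (_ : 0 < #|I|%:R :> R)) ?ltr0n //.
rewrite mulrA -expr2 -[X in _ <= _ * X]/G -EG.
apply: le_trans (ler_wpM2r D0 E1) _; rewrite mulrC lerDr.
by apply: addr_ge0; apply: mulr_ge0 => //; apply: mulr_ge0.
Qed.

(** * Products of Hadamard matrices *)

Lemma hadamard_mul_tr (n : nat) (H : 'M[int]_n) :
  hadamard H -> H^T *m H = n%:R%:M.
Proof.
case: n H => [|n] H [_ HH]; first by apply/matrixP => - [].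
(* Over the rationals [n.+1] is invertible, and a right inverse of a square matrix is also a left
   inverse. *)
pose Q := map_mx (intr : int -> rat) H.
have n0 : n.+1%:R != 0 :> rat by rewrite pnatr_eq0.
have QQ : Q *m Q^T = n.+1%:R%:M.
  by rewrite map_trmx -map_mxM HH map_scalar_mx /= rmorph_nat.
have /mulmx1C QQ1 : Q *m (n.+1%:R^-1 *: Q^T) = 1%:M.
  by rewrite -scalemxAr QQ scale_scalar_mx mulVf.
suff /matrixP E : map_mx (intr : int -> rat) (H^T *m H)
    = map_mx intr (n.+1%:R%:M : 'M[int]_n.+1).
  by apply/matrixP => i j; apply: (@intr_inj rat); have := E i j; rewrite !mxE.
rewrite map_mxM -map_trmx map_scalar_mx /= rmorph_nat -/Q.
rewrite -[in RHS](mulr1 n.+1%:R) -scale_scalar_mx -QQ1.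
by rewrite -scalemxAl scalerA mulfV // scale1r.
Qed.

Lemma sum_sqr_hadamard_mul (n : nat) (H K : 'M[int]_n) (i : 'I_n) :
  hadamard H -> hadamard K -> \sum_j (H *m K^T) i j ^+ 2 = n%:R ^+ 2.
Proof.
move=> [_ HH] hK.
have /matrixP/(_ i i) : (H *m K^T) *m (H *m K^T)^T = (n%:R * n%:R)%:M.
  rewrite trmx_mul trmxK mulmxA -(mulmxA H) hadamard_mul_tr //.
  by rewrite mul_mx_scalar -scalemxAl HH scale_scalar_mx.
rewrite !mxE eqxx mulr1n -expr2 => <-.
by apply: eq_bigr => j _; rewrite [_^T _ _]mxE expr2.
Qed.

(** Row [i] has squared norm [n ^ 2], so an entry of modulus [n] forces the others in that row to
    vanish; [1 < n] supplies another one. *)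
Lemma norm_hadamard_mul_neq (n : nat) (H K : 'M[int]_n) (i j : 'I_n) :
  (1 < n)%N -> hadamard H -> hadamard K ->
  (forall i j, (H *m K^T) i j != 0) -> `|(H *m K^T) i j| != n%:R.
Proof.
move=> n1 hH hK P0; apply/eqP => Pn.
have := sum_sqr_hadamard_mul i hH hK.
rewrite (bigD1 j) //= -(real_normK (num_real _)) Pn.
have [k kj] : exists k : 'I_n, k != j.
  exists (if val j == 0%N then Ordinal n1 else Ordinal (ltnW n1)).
  by rewrite -val_eqE; case: (val j) => [|?].
rewrite (bigD1 k) //= addrC => /(canRL (addrK _)) /eqP.
rewrite subrr paddr_eq0 ?sqr_ge0 //.
  by rewrite sqrf_eq0 (negPf (P0 _ _)).
by apply: sumr_ge0 => l _; exact: sqr_ge0.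
Qed.

Lemma norm_mul_in_sigma (n : nat) (H K : 'M[int]_n) (i j : 'I_n) :
  `|(H *m K^T) i j| \in sigma H K.
Proof. by apply/imfset2P; exists i => //; exists j. Qed.

(** If [n < 2 * c], integrality gives [N + 1 <= 2 * C], while the hypothesis says
    [4 * C ^+ 2 <= 10 * N - 24]; together they yield [(N - 4) ^+ 2 + 9 <= 0]. Here [C] stands for
    one of [A], [B], the square of the other being bounded below by 1. *)
Lemma sqr_double_le_sqr (n c : nat) (N := n%:R : rat) (C := c%:R : rat) :
  0 <= 5 * (N - 2) - 2 * C ^+ 2 - 2 -> 4 * C ^+ 2 <= N ^+ 2.
Proof.
have -> : 4 * C ^+ 2 = (2 * c)%:R ^+ 2 by rewrite natrM; ring.
move=> H; rewrite lerXn2r ?nnegrE // ler_nat leqNgt; apply/negP => nc.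
have : (N + 1) ^+ 2 <= 4 * C ^+ 2.
  have -> : 4 * C ^+ 2 = (2 * c)%:R ^+ 2 by rewrite natrM; ring.
  by rewrite natr1 lerXn2r ?nnegrE ?ler_nat.
have := sqr_ge0 (N - 4).
by move: H; rewrite !expr2; clear; lra.
Qed.

Theorem theorem8p6 (n a b f : nat)
    (n_gt0 : (0 < n)%N) (a_gt0 : (0 < a)%N) (b_gt0 : (0 < b)%N)
    (S_ex : exists S : {fset 'M[int]_n},
      [/\ #|` S| = f,
          forall H : 'M[int]_n, H \in S -> hadamard H,
          mutually_type2_weakly_unbiased S
        & forall H K : 'M[int]_n, H \in S -> K \in S -> H != K ->
            sigma H K = [fset (2 * a)%:Z; (2 * b)%:Z]%fset]) :
  let N : rat := n%:R in
  let A : rat := a%:R in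
  let B : rat := b%:R in
  let D : rat := 15 * N ^+ 2 - 30 * N + 16
                 - 4 * (3 * N - 2) * (A ^+ 2 + B ^+ 2)
                 + 16 * A ^+ 2 * B ^+ 2 in
  (f%:Z <= Num.floor
     ((N ^+ 4 - 10 * N ^+ 3 + 55 * N ^+ 2 - 110 * N + 184) / 5`!%:R))
  /\ (0 < D -> 0 <= 5 * (N - 2) - 2 * A ^+ 2 - 2 * B ^+ 2 ->
      f%:Z <= Num.floor
        ((N ^+ 2 - 4 * A ^+ 2) * (N ^+ 2 - 4 * B ^+ 2) / D)).
Proof.
have [S [Sf Shad _ Ssig]] := S_ex; move=> N A B D.
pose I := (S * 'I_n)%type.
pose x (p : I) i : rat := (val p.1 p.2 i)%:~R.
pose t p q := \sum_i x p i * x q i.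
have cardI : #|{: I}| = (f * n)%N by rewrite card_prod card_ord -cardfE Sf.
have x2 p i : x p i ^+ 2 = 1.
  have [/(_ p.2 i)[] E _] := Shad _ (fsvalP p.1); rewrite /x E.
    by rewrite expr1n.
  by rewrite rmorphN1 sqrrN expr1n.
have tE p q : t p q = ((val p.1 *m (val q.1)^T) p.2 q.2)%:~R.
  rewrite mxE rmorph_sum; apply: eq_bigr => i _.
  by rewrite [_^T _ _]mxE rmorphM.
(* Distinct rows of one matrix are orthogonal, so the factor [t p q] vanishes; rows of different
   matrices have inner product of modulus [2 * a] or [2 * b], which kills a quadratic factor. *)
have xt p q : p != q ->
    t p q * (t p q ^+ 2 - 4 * A ^+ 2) * (t p q ^+ 2 - 4 * B ^+ 2) = 0.
  case: p q => [H i] [K j] pq; rewrite tE /=.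
  have [HK|HK] := eqVneq (val H) (val K).
    have ij : i != j.
      by apply: contra_neq pq => ->; congr pair; apply: val_inj.
    have [_ HH] := Shad _ (fsvalP K).
    by rewrite HK HH mxE (negPf ij) !mul0r.
  have := norm_mul_in_sigma (val H) (val K) i j.
  rewrite (Ssig _ _ (fsvalP H) (fsvalP K) HK) !inE.
  set y := (_ *m _) i j => yab.
  have -> : y%:~R ^+ 2 = `|y|%:~R ^+ 2 :> rat.
    by rewrite intr_norm real_normK ?num_real.
  by case/orP: yab => /eqP->; rewrite -pmulrn natrM -/A -/B; ring.
split.
  rewrite floor_ge_int -pmulrn (_ : 5`!%:R = 120 :> rat) //.
  have [f1|f2] := leqP f 1.
    rewrite ler_pdivlMr //.
    have f1' : f%:R <= 1 :> rat by rewrite lern1.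
    (* This product is the numerator of the bound minus 120, so the bound is at least 1. The first
       two factors have a nonnegative product because [n] is a positive integer. *)
    suff : 0 <= (N - 1) * (N - 2) * (N ^+ 2 - 7 * N + 32) by lra.
    have Q0 : 0 <= N ^+ 2 - 7 * N + 32 by nra.
    apply: mulr_ge0 => //; rewrite /N.
    have [n2|n2] := leqP 2 n.
      by rewrite mulr_ge0 // subr_ge0 ?ler1n ?ler_nat.
    by rewrite (_ : n = 1%N) ?subrr ?mul0r //; lia.
  have [H HS] : exists H, H \in S by apply/fset0Pn; rewrite -cardfs_gt0; lia.
  have [K] : exists K, K \in (S `\ H)%fset.
    by apply/fset0Pn; rewrite -cardfs_gt0; move: f2;
      rewrite -Sf (cardfsD1 H) HS.
  rewrite !inE eq_sym => /andP[HK KS].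
  have P0 i j : (H *m K^T) i j != 0.
    have := norm_mul_in_sigma H K i j.
    by rewrite Ssig // !inE -normr_eq0 => /orP[] /eqP->; lia.
  (* Both [2 * a] and [2 * b] are attained as moduli of entries, as [sigma H K] equals the pair;
     hence neither can be [n]. *)
  have neq c (c0 : (0 < c)%N) : (2 * c)%:Z \in sigma H K ->
      N ^+ 2 - 4 * c%:R ^+ 2 != 0.
    case/imfset2P => i _ [j _ Pc].
    have nc : n != (2 * c)%N.
      apply/eqP => nc; have n1 : (1 < n)%N by lia.
      have := norm_hadamard_mul_neq i j n1 (Shad _ HS) (Shad _ KS) P0.
      by rewrite -Pc natz {1}nc eqxx.
    have -> : 4 * c%:R ^+ 2 = (2 * c)%:R ^+ 2 :> rat by rewrite natrM; ring.
    by rewrite subr_eq0 eqrXn2 // eqr_nat.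
  have N0 : 0 < N by rewrite ltr0n.
  have G0 : N * (N ^+ 2 - 4 * A ^+ 2) * (N ^+ 2 - 4 * B ^+ 2) != 0.
    rewrite !mulf_neq0 ?(gt_eqF N0) //.
      by apply: (neq a a_gt0); rewrite Ssig // !inE eqxx.
    by apply: (neq b b_gt0); rewrite Ssig // !inE eqxx orbT.
  have := card_code_le_bin x2 xt G0.
  (* The sum of binomials is [N] times the claimed bound, so [N] cancels from [f * n]. *)
  by rewrite cardI -(ler_nat rat) natr_bin135 natrM mulrC ler_pM2l.
move=> D0 C0; rewrite floor_ge_int -pmulrn ler_pdivlMr //.
have [f0|f_gt0] := posnP f.
  (* An empty family does not constrain a and b, so the sign of the right-hand
     side has to come from the second hypothesis. *)
  rewrite f0 mul0r.
  have A1 : 1 <= A ^+ 2 by rewrite exprn_ege1 // ler1n.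
  have B1 : 1 <= B ^+ 2 by rewrite exprn_ege1 // ler1n.
  by apply: mulr_ge0; rewrite subr_ge0; apply: sqr_double_le_sqr;
    rewrite -/N -/A -/B; move: A1 B1 C0; clear; lra.
have fn0 : (0 < #|{: I}|)%N by rewrite cardI muln_gt0 f_gt0.
have := card_code_mul_le x2 xt n_gt0 fn0 (ltW D0) C0.
by rewrite cardI natrM -/N -/D mulrAC [_ * N]mulrC -mulrA ler_pM2l ?ltr0n.
Qed.
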